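(* Let $\Omega$ be a quasi-product $(k_1+k_2)$-graph with quasi-factors $\Lambda$ (a $k_1$-graph) and $\Gamma$ (a $k_2$-graph), and let $\Omega_1 = d^{-1}(\mathbb N^{k_1}\times\{0\})$ and $\Omega_2 = d^{-1}(\{0\}\times\mathbb N^{k_2})$, where $d$ is the degree functor of $\Omega$. Then $\Omega_1$ and $\Omega_2$ both decompose as disjoint unions $$\Omega_1=\bigsqcup_{w\in\Gamma^0}\Omega_1^w\times\{w\}\quad\text{and}\quad \Omega_2=\bigsqcup_{x\in\Lambda^0}\{x\}\times\Omega_2^x ,$$ where, for $w\in\Gamma^0$, $\Omega_1^w\times\{w\}$ is the $k_1$-graph $(G(\Lambda)\times\{w\})^*/\!\sim_\Omega$ and, for $x\in\Lambda^0$, $\{x\}\times\Omega_2^x$ is the $k_2$-graph $(\{x\}\times G(\Gamma))^*/\!\sim_\Omega$.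
   Context: Conventions: $\mathbb N=\{0,1,2,\dots\}$ and $e_1,\dots,e_k$ is the standard basis of $\mathbb N^k$. A $k$-graph is a countable category $\Lambda$ (objects identified with identity morphisms) with a functor $d:\Lambda\to\mathbb N^k$ such that whenever $d(\lambda)=m+n$ there are unique $\mu,\nu\in\Lambda$ with $\lambda=\mu\nu$, $d(\mu)=m$, $d(\nu)=n$. Write $\Lambda^0=d^{-1}(0)$ (the objects), and $r(\lambda),s(\lambda)$ for range and source; $\mu\nu$ is defined when $s(\mu)=r(\nu)$. The one-skeleton $G(\Lambda)$ is the edge-colored directed graph with vertex set $\Lambda^0$, edge set $\{\lambda: d(\lambda)\in\{e_1,\dots,e_k\}\}$, source and range inherited from $\Lambda$, and $d(e)$ as the color of the edge $e$. Isomorphisms of edge-colored directed graphs preserve source, range and color. For a directed graph $G$, $G^*$ is its category of finite paths $p_1\cdots p_n$ with $s(p_i)=r(p_{i+1})$ (vertices are the paths of length $0$). For paths $p,p'\in G(\Omega)^*$, $p\sim_\Omega p'$ means that $p$ and $p'$ have the same composite in $\Omega$; thus $\Omega = G(\Omega)^*/\!\sim_\Omega$. If $\Lambda$ is a $k_1$-graph and $\Gamma$ a $k_2$-graph, $\Lambda\times\Gamma$ is the product $(k_1+k_2)$-graph with degree $(d_\Lambda,d_\Gamma)$. Its one-skeleton has vertices $\Lambda^0\times\Gamma^0$ and edges $(e,v)$ ($e$ an edge of $G(\Lambda)$, $v\in\Gamma^0$; colored as $e$) and $(x,f)$ ($x\in\Lambda^0$, $f$ an edge of $G(\Gamma)$;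 colored $e_{k_1+j}$ if $f$ has color $e_j$), with source and range computed coordinatewise. A $(k_1+k_2)$-graph $\Omega$ is a quasi-product with quasi-factors $\Lambda$ (a $k_1$-graph) and $\Gamma$ (a $k_2$-graph) if: (i) $G(\Omega)\cong G(\Lambda\times\Gamma)$; (ii) there are injective functors $\psi_1:\Lambda\to\Omega$ and $\psi_2:\Gamma\to\Omega$; (iii) $d_\Lambda=\pi_1 d_\Omega\psi_1$ and $d_\Gamma=\pi_2d_\Omega\psi_2$, where $\pi_i:\mathbb N^{k_1+k_2}=\mathbb N^{k_1}\times\mathbb N^{k_2}\to\mathbb N^{k_i}$ are the projections. One fixes the identification $G(\Omega)=G(\Lambda\times\Gamma)$ and labels edges and paths of $G(\Omega)$ accordingly; in particular $G(\Lambda)\times\{w\}$ and $\{x\}\times G(\Gamma)$ are subgraphs of $G(\Omega)$. *)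

(* Defs.v *)
From HB Require Import structures.
From mathcomp Require Import all_boot all_order all_algebra.
From mathcomp Require Import generic_quotient.

Set Implicit Arguments.
Unset Strict Implicit.
Unset Printing Implicit Defensive.

Import GRing.Theory.
Local Open Scope ring_scope.
Local Open Scope quotient_scope.

(* Categories are single-sorted: an object is its identity morphism, so [ran]
   and [src] take values in morphisms.  [compose a b] is the composite ab, which is
   meaningful only when [src a = ran b]; its other values are junk, and every
   law below is guarded accordingly. *)
Record catData := CatData {
  mor :> countType;
  ran : mor -> mor;
  src : mor -> mor;
  compose : mor -> mor -> mor }.

Record is_category (C : catData) : Prop := IsCategory {
  src_ran : forall a : C, src (ran a) = ran a;
  ran_src : forall a : C, ran (src a) = src a;
  ran_compose : forall a b : C, src a = ran b -> ran (compose a b) = ran a;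
  src_compose : forall a b : C, src a = ran b -> src (compose a b) = src b;
  compose_ran : forall a : C, compose (ran a) a = a;
  compose_src : forall a : C, compose a (src a) = a;
  composeA : forall a b c : C, src a = ran b -> src b = ran c ->
    compose a (compose b c) = compose (compose a b) c }.

(* Identities are preserved because they are exactly the values of [ran]. *)
Record is_functor (C D : catData) (F : C -> D) : Prop := IsFunctor {
  functor_ran : forall a, F (ran a) = ran (F a);
  functor_src : forall a, F (src a) = src (F a);
  functor_compose : forall a b, src a = ran b -> F (compose a b) = compose (F a) (F b) }.

(* N^k is 'rV[nat]_k, the basis vector e_i is [delta_mx 0 i], and
   N^(k1 + k2) = N^k1 x N^k2 via [row_mx], with projections [lsubmx], [rsubmx]. *)
Record kgraphData (k : nat) := KGraphData {
  kcat :> catData;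
  deg : kcat -> 'rV[nat]_k }.

Record is_kgraph (k : nat) (L : kgraphData k) : Prop := IsKGraph {
  kgraph_category : is_category L;
  deg_ran : forall a : L, deg (ran a) = 0;
  deg_compose : forall a b : L, src a = ran b -> deg (compose a b) = deg a + deg b;
  factorization : forall (a : L) (m n : 'rV[nat]_k), deg a = m + n ->
    exists! bc : L * L,
      [/\ src bc.1 = ran bc.2, a = compose bc.1 bc.2, deg bc.1 = m & deg bc.2 = n] }.

Record kgraph (k : nat) := KGraph {
  kdata :> kgraphData k;
  kgraphP : is_kgraph kdata }.

Record is_kgraph_iso (k : nat) (L M : kgraphData k) (F : L -> M) : Prop :=
  IsKGraphIso {
    iso_functor : is_functor F;
    iso_bij : bijective F;
    iso_deg : forall a, deg (F a) = deg a }.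

Lemma deg_src k (L : kgraph k) (a : L) : deg (src a) = 0.
Proof.
rewrite -(ran_src (kgraph_category (kgraphP L))); exact: deg_ran (kgraphP L) _.
Qed.

Lemma ran_deg0 k (L : kgraph k) (a : L) : deg a = 0 -> ran a = a.
Proof.
case: (kgraphP L) => C d0 _ F da.
have [bc [_ U]] := F a 0 0 (etrans da (esym (addr0 0))).
have e1 : bc = (ran a, a).
  by apply: U; split=> //=; rewrite ?(src_ran C) ?(compose_ran C) ?d0.
have : bc = (a, src a).
  by apply: U; split=> //=; rewrite ?(ran_src C) ?(compose_src C) ?deg_src.
by rewrite e1 => -[].
Qed.

Lemma src_deg0 k (L : kgraph k) (a : L) : deg a = 0 -> src a = a.
Proof.
by move=> /ran_deg0 <-; rewrite (src_ran (kgraph_category (kgraphP L))).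
Qed.

Section Product.
Variables (k1 k2 : nat) (L : kgraph k1) (G : kgraph k2).

Definition kprod_data : kgraphData (k1 + k2) :=
  @KGraphData (k1 + k2)
    (@CatData (L * G)%type
       (fun a => (ran a.1, ran a.2))
       (fun a => (src a.1, src a.2))
       (fun a b => (compose a.1 b.1, compose a.2 b.2)))
    (fun a => row_mx (deg a.1) (deg a.2)).

Lemma kprod_is_kgraph : is_kgraph kprod_data.
Proof.
case: (kgraphP L) => -[L1 L2 L3 L4 L5 L6 L7] L8 L9 L10.
case: (kgraphP G) => -[G1 G2 G3 G4 G5 G6 G7] G8 G9 G10.
split; first split.
- by case=> a a' /=; rewrite L1 G1.
- by case=> a a' /=; rewrite L2 G2.
- by case=> a a' [b b'] [/L3 e /G3 e'] /=; rewrite e e'.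
- by case=> a a' [b b'] [/L4 e /G4 e'] /=; rewrite e e'.
- by case=> a a' /=; rewrite L5 G5.
- by case=> a a' /=; rewrite L6 G6.
- by case=> a a' [b b'] [c c'] [e1 e1'] [e2 e2'] /=; rewrite L7 // G7.
- by case=> a a' /=; rewrite L8 G8 row_mx0.
- by case=> a a' [b b'] [e e'] /=; rewrite L9 // G9 // add_row_mx.
case=> a a' m n /= E.
have /L10[[b c] /= [[h1 h2 h3 h4] U]] : deg a = lsubmx m + lsubmx n.
  by move: (congr1 lsubmx E); rewrite row_mxKl; move->; apply/rowP=> i; rewrite !mxE.
have /G10[[b' c'] /= [[h1' h2' h3' h4'] U']] : deg a' = rsubmx m + rsubmx n.
  by move: (congr1 rsubmx E); rewrite row_mxKr; move->; apply/rowP=> i; rewrite !mxE.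
exists ((b, b'), (c, c')); split=> /=.
  split; first by rewrite h1 h1'.
  - by rewrite -h2 -h2'.
  - by rewrite h3 h3' hsubmxK.
  - by rewrite h4 h4' hsubmxK.
case=> -[x x'] [y y'] /= [[e1 e1'] [e2 e2'] em en].
have [? ?] : (b, c) = (x, y).
  by apply: U; split=> //=; rewrite -?em -?en row_mxKl.
have [? ?] : (b', c') = (x', y').
  by apply: U'; split=> //=; rewrite -?em -?en row_mxKr.
by subst.
Qed.

Definition kprod : kgraph (k1 + k2) := KGraph kprod_is_kgraph.
End Product.

Record cgraph (C : Type) := CGraph {
  vert : countType;
  edge : countType;
  eran : edge -> vert;
  esrc : edge -> vert;
  color : edge -> C }.

Section Skeleton.
Variables (k : nat) (L : kgraph k).

Definition is_vertex (a : L) : bool := deg a == 0.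
Definition is_edge (a : L) : bool := [exists i, deg a == delta_mx 0 i].

Lemma ran_is_vertex (a : L) : is_vertex (ran a).
Proof. exact/eqP/(deg_ran (kgraphP L)). Qed.

Lemma src_is_vertex (a : L) : is_vertex (src a).
Proof. exact/eqP/deg_src. Qed.

Definition skeleton : cgraph 'rV[nat]_k :=
  @CGraph _ {x : L | is_vertex x} {e : L | is_edge e}
    (fun e => exist _ (ran (val e)) (ran_is_vertex _))
    (fun e => exist _ (src (val e)) (src_is_vertex _))
    (fun e => deg (val e)).

Lemma ran_vertex (v : vert skeleton) : ran (val v) = val v.
Proof. exact/ran_deg0/eqP/(valP v). Qed.

Lemma src_vertex (v : vert skeleton) : src (val v) = val v.
Proof. exact/src_deg0/eqP/(valP v). Qed.
End Skeleton.

Record cgraph_iso (C : Type) (G H : cgraph C) := CGraphIso {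
  isov : vert G -> vert H;
  isoe : edge G -> edge H;
  isov_inv : vert H -> vert G;
  isoe_inv : edge H -> edge G;
  isovK : cancel isov isov_inv;
  isov_invK : cancel isov_inv isov;
  isoeK : cancel isoe isoe_inv;
  isoe_invK : cancel isoe_inv isoe;
  iso_eran : forall e, eran (isoe e) = isov (eran e);
  iso_esrc : forall e, esrc (isoe e) = isov (esrc e);
  iso_color : forall e, color (isoe e) = color e }.

(* Colors are ignored here, so that a graph colored by N^k1 can be included in
   one colored by N^(k1 + k2). *)
Record graph_hom (C D : Type) (G : cgraph C) (H : cgraph D) := GraphHom {
  homv : vert G -> vert H;
  home : edge G -> edge H;
  hom_eran : forall e, eran (home e) = homv (eran e);
  hom_esrc : forall e, esrc (home e) = homv (esrc e) }.

Section GraphHomTheory.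
Variables (C D E : Type) (G : cgraph C) (H : cgraph D) (K : cgraph E).
Variables (f : graph_hom G H) (g : graph_hom H K).

Lemma comp_hom_eran e :
  eran (home g (home f e)) = homv g (homv f (eran e)).
Proof. by rewrite !hom_eran. Qed.

Lemma comp_hom_esrc e :
  esrc (home g (home f e)) = homv g (homv f (esrc e)).
Proof. by rewrite !hom_esrc. Qed.

Definition graph_hom_comp : graph_hom G K :=
  @GraphHom _ _ G K (fun v => homv g (homv f v)) (fun e => home g (home f e))
    comp_hom_eran comp_hom_esrc.
End GraphHomTheory.

Section IsoInverse.
Variables (C : Type) (G H : cgraph C) (f : cgraph_iso G H).

Lemma iso_inv_eran e : eran (isoe_inv f e) = isov_inv f (eran e).
Proof. by rewrite -[in RHS](isoe_invK f e) iso_eran isovK. Qed.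

Lemma iso_inv_esrc e : esrc (isoe_inv f e) = isov_inv f (esrc e).
Proof. by rewrite -[in RHS](isoe_invK f e) iso_esrc isovK. Qed.

Definition iso_inv_hom : graph_hom H G :=
  @GraphHom _ _ H G (isov_inv f) (isoe_inv f) iso_inv_eran iso_inv_esrc.
End IsoInverse.

Section Paths.
Variables (C : Type) (G : cgraph C).

(* A path p_1 ... p_n is stored as its range vertex together with its edges;
   the path of length 0 at x is (x, [::]). *)
Fixpoint is_path (x : vert G) (es : seq (edge G)) : bool :=
  if es is e :: es' then (eran e == x) && is_path (esrc e) es' else true.

Definition gpath := {p : vert G * seq (edge G) | is_path p.1 p.2}.

Definition prange (p : gpath) : vert G := (val p).1.
Definition pedges (p : gpath) : seq (edge G) := (val p).2.
Definition psource (p : gpath) : vert G := last (prange p) (map (@esrc _ G) (pedges p)).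

Definition pvertex (x : vert G) : gpath := exist _ (x, [::]) isT.

(* [insubd p] only supplies a junk value when p and q are not composable. *)
Definition pcat (p q : gpath) : gpath := insubd p (prange p, pedges p ++ pedges q).

Definition path_cat : catData :=
  @CatData gpath (fun p => pvertex (prange p)) (fun p => pvertex (psource p)) pcat.
End Paths.

Section PathMap.
Variables (C D : Type) (G : cgraph C) (H : cgraph D) (f : graph_hom G H).

Lemma is_path_map x es : is_path x es -> is_path (homv f x) (map (home f) es).
Proof.
elim: es x => //= e es IH x /andP[/eqP <- /IH].
by rewrite hom_eran hom_esrc eqxx.
Qed.

Definition map_gpath (p : gpath G) : gpath H :=
  exist _ (homv f (prange p), map (home f) (pedges p)) (is_path_map (valP p)).
End PathMap.

(* The trailing identity at the source covers paths of length 0. *)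
Definition composite (k : nat) (L : kgraph k) (p : gpath (skeleton L)) : L :=
  foldr (@compose L) (val (psource p)) (map val (pedges p)).

(* Operations are computed on representatives; they do not depend on the choice
   when R is a congruence. *)
Section QuotientCategory.
Variables (C : catData) (R : equiv_rel C).

Definition quot_type := {eq_quot R}.
HB.instance Definition _ := Quotient.on quot_type.
HB.instance Definition _ := Choice.on quot_type.
HB.instance Definition _ : isCountable quot_type :=
  CanIsCountable (@reprK _ quot_type).

Definition quot_cat : catData :=
  @CatData quot_type
    (fun a => \pi_quot_type (ran (repr a)))
    (fun a => \pi_quot_type (src (repr a)))
    (fun a b => \pi_quot_type (compose (repr a) (repr b))).
End QuotientCategory.

(* The quotient H^* / ~_L for a graph H included in the skeleton of L by i,
   where p ~_L q means that p and q have the same composite in L, graded by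
   adding up the colors of the edges of a path. *)
Section PathQuotient.
Variables (k l : nat) (L : kgraph k) (H : cgraph 'rV[nat]_l).
Variable i : graph_hom H (skeleton L).

Definition path_eqv (p q : path_cat H) : bool :=
  composite (map_gpath i p) == composite (map_gpath i q).

Lemma path_eqv_class : equiv_class_of path_eqv.
Proof. by split=> [p|p q|p q r]; rewrite /path_eqv // => /eqP->. Qed.

Definition path_equiv : equiv_rel (path_cat H) := EquivRelPack path_eqv_class.

Definition path_deg (p : gpath H) : 'rV[nat]_l := \sum_(e <- pedges p) color e.

Definition path_quot : kgraphData l :=
  @KGraphData l (quot_cat path_equiv) (fun a => path_deg (repr a)).
End PathQuotient.

Definition path_class (k l : nat) (L : kgraph k) (H : cgraph 'rV[nat]_l)
    (i : graph_hom H (skeleton L)) (p : gpath H) : path_quot i :=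
  \pi_(quot_type (path_equiv i)) p.

Section DisjointUnion.
Variables (k : nat) (I : countType) (F : I -> kgraphData k).

(* [tagged_as u v] is v transported to the component of u, when v lies in it. *)
Definition dunion : kgraphData k :=
  @KGraphData k
    (@CatData {i : I & F i}
       (fun u => Tagged (fun i => F i) (ran (tagged u)))
       (fun u => Tagged (fun i => F i) (src (tagged u)))
       (fun u v => Tagged (fun i => F i) (compose (tagged u) (tagged_as u v))))
    (fun u => deg (tagged u)).

Definition dinj (i : I) (a : F i) : dunion := Tagged (fun i => F i) a.
End DisjointUnion.

Section QuasiProduct.
Variables (k1 k2 : nat) (Om : kgraph (k1 + k2)) (L : kgraph k1) (G : kgraph k2).

Record quasi_product := QuasiProduct {
  qp_iso : cgraph_iso (skeleton Om) (skeleton (kprod L G));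
  qp_psi1 : L -> Om;
  qp_psi2 : G -> Om;
  qp_psi1_functor : is_functor qp_psi1;
  qp_psi2_functor : is_functor qp_psi2;
  qp_psi1_inj : injective qp_psi1;
  qp_psi2_inj : injective qp_psi2;
  qp_deg1 : forall a, deg a = lsubmx (deg (qp_psi1 a));
  qp_deg2 : forall b, deg b = rsubmx (deg (qp_psi2 b)) }.
End QuasiProduct.

(* The subcategories d^-1(N^k1 x 0) and d^-1(0 x N^k2), graded by N^k1 and
   N^k2.  As for paths, [insubd] is junk only on noncomposable pairs. *)
Section Omega12.
Variables (k1 k2 : nat) (Om : kgraph (k1 + k2)).

Lemma rsubmx_ran (a : Om) : rsubmx (deg (ran a)) == 0.
Proof. by rewrite (deg_ran (kgraphP Om)) linear0. Qed.

Lemma rsubmx_src (a : Om) : rsubmx (deg (src a)) == 0.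
Proof. by rewrite deg_src linear0. Qed.

Lemma lsubmx_ran (a : Om) : lsubmx (deg (ran a)) == 0.
Proof. by rewrite (deg_ran (kgraphP Om)) linear0. Qed.

Lemma lsubmx_src (a : Om) : lsubmx (deg (src a)) == 0.
Proof. by rewrite deg_src linear0. Qed.

Definition Omega1 : kgraphData k1 :=
  @KGraphData k1
    (@CatData {a : Om | rsubmx (deg a) == 0}
       (fun a => exist _ (ran (val a)) (rsubmx_ran _))
       (fun a => exist _ (src (val a)) (rsubmx_src _))
       (fun a b => insubd a (compose (val a) (val b))))
    (fun a => lsubmx (deg (val a))).

Definition Omega2 : kgraphData k2 :=
  @KGraphData k2
    (@CatData {a : Om | lsubmx (deg a) == 0}
       (fun a => exist _ (ran (val a)) (lsubmx_ran _))
       (fun a => exist _ (src (val a)) (lsubmx_src _))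
       (fun a b => insubd a (compose (val a) (val b))))
    (fun a => rsubmx (deg (val a))).
End Omega12.

(* The graphs H x {w} and {x} x H, colored as H. *)
Section Slices.
Variables (C D : Type) (H : cgraph C) (K : cgraph D).

Definition graph_slice1 (w : vert K) : cgraph C :=
  @CGraph C {v : vert H * vert K | v.2 == w} {e : edge H * vert K | e.2 == w}
    (fun e => exist _ (eran (val e).1, w) (eqxx w))
    (fun e => exist _ (esrc (val e).1, w) (eqxx w))
    (fun e => color (val e).1).

Definition graph_slice2 (x : vert H) : cgraph D :=
  @CGraph D {v : vert H * vert K | v.1 == x} {e : vert H * edge K | e.1 == x}
    (fun e => exist _ (x, eran (val e).2) (eqxx x))
    (fun e => exist _ (x, esrc (val e).2) (eqxx x))
    (fun e => color (val e).2).
End Slices.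

(* G(L) x {w} and {x} x G(G) as subgraphs of G(L x G). *)
Section SliceInclusion.
Variables (k1 k2 : nat) (L : kgraph k1) (G : kgraph k2).

Lemma pair_is_vertex (v : vert (skeleton L)) (w : vert (skeleton G)) :
  @is_vertex _ (kprod L G) (val v, val w).
Proof.
by rewrite /is_vertex /= (eqP (valP v)) (eqP (valP w)) row_mx0.
Qed.

Lemma pair_is_edge1 (e : edge (skeleton L)) (w : vert (skeleton G)) :
  @is_edge _ (kprod L G) (val e, val w).
Proof.
case/existsP: (valP e) => i /eqP di; apply/existsP; exists (lshift k2 i).
by rewrite /= di (eqP (valP w)) delta_mx_lshift.
Qed.

Lemma pair_is_edge2 (x : vert (skeleton L)) (f : edge (skeleton G)) :
  @is_edge _ (kprod L G) (val x, val f).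
Proof.
case/existsP: (valP f) => i /eqP di; apply/existsP; exists (rshift k1 i).
by rewrite /= di (eqP (valP x)) delta_mx_rshift.
Qed.

Definition incl_vertex (v : vert (skeleton L) * vert (skeleton G)) :
    vert (skeleton (kprod L G)) :=
  exist _ (val v.1, val v.2) (pair_is_vertex v.1 v.2).

Section AtW.
Variable w : vert (skeleton G).
Let S := graph_slice1 (skeleton L) w.

Definition incl_edge1 (e : edge S) : edge (skeleton (kprod L G)) :=
  exist _ (val (val e).1, val (val e).2) (pair_is_edge1 (val e).1 (val e).2).

Lemma incl_eran1 e : eran (incl_edge1 e) = incl_vertex (val (eran e)).
Proof.
case: e => -[e w'] /= /eqP ->; apply: val_inj => /=.
by rewrite ran_vertex.
Qed.

Lemma incl_esrc1 e : esrc (incl_edge1 e) = incl_vertex (val (esrc e)).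
Proof.
case: e => -[e w'] /= /eqP ->; apply: val_inj => /=.
by rewrite src_vertex.
Qed.

Definition slice1_incl : graph_hom S (skeleton (kprod L G)) :=
  @GraphHom _ _ S _ (fun v => incl_vertex (val v)) incl_edge1 incl_eran1 incl_esrc1.
End AtW.

Section AtX.
Variable x : vert (skeleton L).
Let S := graph_slice2 (skeleton G) x.

Definition incl_edge2 (e : edge S) : edge (skeleton (kprod L G)) :=
  exist _ (val (val e).1, val (val e).2) (pair_is_edge2 (val e).1 (val e).2).

Lemma incl_eran2 e : eran (incl_edge2 e) = incl_vertex (val (eran e)).
Proof.
case: e => -[x' e] /= /eqP ->; apply: val_inj => /=.
by rewrite ran_vertex.
Qed.

Lemma incl_esrc2 e : esrc (incl_edge2 e) = incl_vertex (val (esrc e)).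
Proof.
case: e => -[x' e] /= /eqP ->; apply: val_inj => /=.
by rewrite src_vertex.
Qed.

Definition slice2_incl : graph_hom S (skeleton (kprod L G)) :=
  @GraphHom _ _ S _ (fun v => incl_vertex (val v)) incl_edge2 incl_eran2 incl_esrc2.
End AtX.
End SliceInclusion.

(* Through the identification of G(L x G) with G(Om), these become subgraphs of
   G(Om), and the fibres are (G(L) x {w})^* / ~_Om and ({x} x G(G))^* / ~_Om. *)
Section Fibres.
Variables (k1 k2 : nat) (Om : kgraph (k1 + k2)) (L : kgraph k1) (G : kgraph k2).
Variable Q : quasi_product Om L G.

Definition slice1_hom (w : vert (skeleton G)) :=
  graph_hom_comp (slice1_incl L w) (iso_inv_hom (qp_iso Q)).

Definition slice2_hom (x : vert (skeleton L)) :=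
  graph_hom_comp (slice2_incl G x) (iso_inv_hom (qp_iso Q)).

Definition fibre1 (w : vert (skeleton G)) : kgraphData k1 := path_quot (slice1_hom w).
Definition fibre2 (x : vert (skeleton L)) : kgraphData k2 := path_quot (slice2_hom x).
End Fibres.

(* Main.v *)
Require Import Defs.
From mathcomp Require Import all_boot all_order all_algebra.
From mathcomp Require Import generic_quotient.

(** The fibre over w is the set of composites of paths inside G(Lam) x {w}, so
    everything reduces to two facts about the coloured subgraph of G(Om).
    Since the second coordinate does not change along an edge coloured in
    N^k1, an edge with a colour in N^k1 whose range lies in the slice over w
    lies in that slice itself; factoring an element of degree in N^k1 x 0 into
    edges then shows that it is a composite of a path in exactly one slice,
    the one containing its range.  Each fibre thus embeds in Om as a
    subcategory closed under factorization, and a subcategory closed under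
    factorization inherits the unique factorization property. *)

Set Implicit Arguments.
Unset Strict Implicit.
Unset Printing Implicit Defensive.

Import GRing.Theory.

(** * Composites of paths in the one-skeleton *)

Section Composite.
Local Open Scope ring_scope.
Variables (k : nat) (Om : kgraph k).
Let S := skeleton Om.

(** Free of the proof of [is_path], so that induction on the edges can change the range vertex. *)
Let edges_composite (x : vert S) (es : seq (edge S)) : Om :=
  foldr (@compose Om) (val (last x (map (@esrc _ S) es))) (map val es).

Let ran_edges_composite x es :
  is_path x es -> ran (edges_composite x es) = val x.
Proof.
have C := kgraph_category (kgraphP Om).
elim: es x => [|e es IH] x /=; first by rewrite ran_vertex.
case/andP=> /eqP <- /IH E.
by rewrite /edges_composite /= (ran_compose C) // -/(edges_composite (esrc e) es) E.
Qed.

Let src_edges_composite x es : is_path x es ->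
  src (edges_composite x es) = val (last x (map (@esrc _ S) es)).
Proof.
have C := kgraph_category (kgraphP Om).
elim: es x => [|e es IH] x /=; first by rewrite src_vertex.
case/andP=> _ pes; rewrite -(IH _ pes) /edges_composite /= (src_compose C) //.
by rewrite -/(edges_composite (esrc e) es) ran_edges_composite.
Qed.

Let deg_edges_composite x es : is_path x es ->
  deg (edges_composite x es) = \sum_(e <- es) color e.
Proof.
elim: es x => [|e es IH] x /=; first by rewrite big_nil (eqP (valP x)).
case/andP=> _ pes; rewrite big_cons -(IH _ pes) /edges_composite /=.
rewrite (deg_compose (kgraphP Om)) //.
by rewrite -/(edges_composite (esrc e) es) ran_edges_composite.
Qed.

Let edges_composite_cat x y es fs : is_path x es -> is_path y fs ->
  last x (map (@esrc _ S) es) = y ->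
  edges_composite x (es ++ fs) =
    compose (edges_composite x es) (edges_composite y fs).
Proof.
have C := kgraph_category (kgraphP Om).
move=> + pfs; elim: es x => [|e es IH] x /=.
  (* The empty path contributes the identity at [y], which is the range of the second composite. *)
  by move=> _ ->; rewrite -[X in compose X](ran_edges_composite pfs) (compose_ran C).
case/andP=> _ pes E; rewrite {1 2}/edges_composite /=.
rewrite -!/(edges_composite (esrc e) _) IH // (composeA C) //.
  by rewrite ran_edges_composite.
by rewrite src_edges_composite // E ran_edges_composite.
Qed.

Lemma ran_composite (p : gpath S) : ran (composite p) = val (prange p).
Proof. exact: ran_edges_composite (valP p). Qed.

Lemma src_composite (p : gpath S) : src (composite p) = val (psource p).
Proof. exact: src_edges_composite (valP p). Qed.

Lemma deg_composite (p : gpath S) : deg (composite p) = path_deg p.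
Proof. exact: deg_edges_composite (valP p). Qed.

(** The path [r] is given by its value because the lemma is applied to the image of a [pcat] under a
    graph map, which is not literally a [pcat]. *)
Lemma composite_cat (p q r : gpath S) : psource p = prange q ->
  val r = (prange p, pedges p ++ pedges q) ->
  composite r = compose (composite p) (composite q).
Proof.
move=> pq Er; rewrite /composite /psource /prange /pedges Er /=.
exact: edges_composite_cat (valP p) (valP q) pq.
Qed.

End Composite.

(** * Concatenation and images of paths *)

Lemma is_path_cat (C : Type) (H : cgraph C) (x : vert H) es fs :
  is_path x (es ++ fs) = is_path x es && is_path (last x (map (@esrc _ H) es)) fs.
Proof. by elim: es x => //= e es IH x; rewrite IH andbA. Qed.

Lemma val_pcat (C : Type) (H : cgraph C) (p q : gpath H) :
  psource p = prange q -> val (pcat p q) = (prange p, pedges p ++ pedges q).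
Proof.
(* Composability makes the concatenation a path, so the default value of [insubd] is not reached. *)
move=> pq; rewrite insubdK // unfold_in /= is_path_cat (valP p) /=.
by rewrite -/(psource p) pq (valP q).
Qed.

Lemma psource_map (C D : Type) (H : cgraph C) (K : cgraph D) (h : graph_hom H K) p :
  psource (map_gpath h p) = homv h (psource p).
Proof.
rewrite /psource -(last_map (homv h)) /= -!map_comp; congr (last _ _).
by apply: eq_map => e /=; rewrite hom_esrc.
Qed.

(** * Subcategories closed under factorization *)

Section FactorClosed.
Local Open Scope ring_scope.
Variables (k l : nat) (Om : kgraph k) (F : kgraphData l).
Variables (ev : F -> Om) (iota : 'rV[nat]_l -> 'rV[nat]_k).
Hypotheses (ev_inj : injective ev) (ev_functor : is_functor ev).
Hypotheses (iotaD : {morph iota : m n / m + n}) (iota0 : iota 0 = 0).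
Hypotheses (iota_inj : injective iota).
Hypothesis deg_ev : forall a, deg (ev a) = iota (deg a).
Hypothesis ev_factor : forall a b c m n, src b = ran c -> ev a = compose b c ->
  deg b = iota m -> deg c = iota n -> exists b' c', ev b' = b /\ ev c' = c.

(** Each law is an equation that can be checked in [Om] after applying the injective [ev], or [iota]
    for degrees. Factorizations exist by [ev_factor]; they are unique because their images in [Om]
    are. *)
Lemma factor_closed_kgraph : is_kgraph F.
Proof.
have [C d0 dM fact] := kgraphP Om; case: ev_functor => evr evs evM.
have ev_comp a b : src a = ran b -> src (ev a) = ran (ev b).
  by rewrite -evs -evr => ->.
split; first split.
- by move=> a; apply: ev_inj; rewrite evs !evr (src_ran C).
- by move=> a; apply: ev_inj; rewrite evr !evs (ran_src C).
- move=> a b ab; apply: ev_inj; rewrite !evr evM //.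
  by rewrite (ran_compose C) // (ev_comp _ _ ab).
- move=> a b ab; apply: ev_inj; rewrite !evs evM //.
  by rewrite (src_compose C) // (ev_comp _ _ ab).
- move=> a; apply: ev_inj; rewrite evM ?evr ?(compose_ran C) //.
  by apply: ev_inj; rewrite evs !evr (src_ran C).
- move=> a; apply: ev_inj; rewrite evM ?evs ?(compose_src C) //.
  by apply: ev_inj; rewrite evr !evs (ran_src C).
- move=> a b c ab bc.
  (* Applying [evM] to a triple composite needs composability in [F], which is itself pulled back
     along [ev]. *)
  have ab_c : src (compose a b) = ran c.
    by apply: ev_inj; rewrite evs evM // (src_compose C)
      ?(ev_comp _ _ ab) // evr (ev_comp _ _ bc).
  have a_bc : src a = ran (compose b c).
    by apply: ev_inj; rewrite evr evM // (ran_compose C)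
      ?(ev_comp _ _ bc) // evs (ev_comp _ _ ab).
  by apply: ev_inj; rewrite !evM // (composeA C) // ?(ev_comp _ _ ab) ?(ev_comp _ _ bc).
- by move=> a; apply: iota_inj; rewrite -deg_ev evr d0 iota0.
- move=> a b ab; apply: iota_inj.
  by rewrite iotaD -!deg_ev evM // dM // (ev_comp _ _ ab).
move=> a m n da.
have [|[b c] /= [[bc abc db dc] U]] := fact (ev a) (iota m) (iota n).
  by rewrite deg_ev da iotaD.
have /= [b' [c' [eb ec]]] := ev_factor bc abc db dc.
have bc' : src b' = ran c' by apply: ev_inj; rewrite evs evr eb ec.
exists (b', c'); split=> /=.
  split=> //; first by apply: ev_inj; rewrite evM // eb ec.
    by apply: iota_inj; rewrite -deg_ev eb.
  by apply: iota_inj; rewrite -deg_ev ec.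
case=> b2 c2 /= [bc2 a2 db2 dc2].
have [] : (b, c) = (ev b2, ev c2).
  apply: U; split=> /=; first exact: ev_comp.
  - by rewrite a2 evM.
  - by rewrite deg_ev db2.
  - by rewrite deg_ev dc2.
by rewrite -eb -ec => /ev_inj -> /ev_inj ->.
Qed.

End FactorClosed.

(** * Path quotients embedded in a k-graph *)

(* [h] makes H a subgraph of G(Om) whose colours are read in N^k through
   [iota], and which is closed under the edges of these colours. *)
Record lifts_edges (k l : nat) (Om : kgraph k) (iota : 'rV[nat]_l -> 'rV[nat]_k)
    (H : cgraph 'rV[nat]_l) (h : graph_hom H (skeleton Om)) : Prop := LiftsEdges {
  homv_inj : injective (homv h);
  color_home : forall e, color (home h e) = iota (color e);
  home_lift : forall (e : edge (skeleton Om)) (j : 'I_l) (x : vert H),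
    color e = iota (delta_mx 0 j)%R -> eran e = homv h x ->
    exists e', home h e' = e }.

(** Abstracts the two coordinate inclusions into N^(k1 + k2), so that both halves of the theorem
    share one argument. By [emb_delta], a morphism of degree [iota (delta_mx 0 j)] is an edge. *)
Record degree_embedding (k l : nat) (iota : 'rV[nat]_l -> 'rV[nat]_k) : Prop :=
  DegreeEmbedding {
    embD : {morph iota : m n / (m + n)%R};
    emb0 : iota 0%R = 0%R;
    emb_inj : injective iota;
    emb_delta : forall j, exists i, iota (delta_mx 0 j)%R = delta_mx 0%R i }.

Section PathQuotientEmbedding.
Local Open Scope ring_scope.
Local Open Scope quotient_scope.
Variables (k l : nat) (Om : kgraph k) (iota : 'rV[nat]_l -> 'rV[nat]_k).
Hypothesis iotaP : degree_embedding iota.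
Variables (H : cgraph 'rV[nat]_l) (h : graph_hom H (skeleton Om)).
Hypothesis hP : lifts_edges iota h.

Definition quot_eval (a : path_quot h) : Om := composite (map_gpath h (repr a)).

Lemma quot_eval_class p : quot_eval (path_class h p) = composite (map_gpath h p).
Proof.
(* [reprK] is restated in [{eq_quot _}], where [eqmodP] turns it into equality of composites. *)
have E : \pi_{eq_quot path_equiv h} (repr (path_class h p)) =
    \pi_{eq_quot path_equiv h} p by exact: reprK (path_class h p).
by move/eqmodP/eqP: E.
Qed.

Lemma path_class_repr (a : path_quot h) : path_class h (repr a) = a.
Proof. exact: reprK. Qed.

Lemma quot_eval_inj : injective quot_eval.
Proof.
move=> a b eab; rewrite -(path_class_repr a) -(path_class_repr b).
by apply/eqmodP; apply/eqP.
Qed.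

Lemma ran_quot_eval a : ran (quot_eval a) = val (homv h (prange (repr a))).
Proof. exact: ran_composite. Qed.

Lemma src_quot_eval a : src (quot_eval a) = val (homv h (psource (repr a))).
Proof. by rewrite src_composite psource_map. Qed.

Lemma composite_pvertex x :
  composite (map_gpath h (pvertex x)) = val (homv h x).
Proof. by []. Qed.

Lemma quot_eval_functor : is_functor quot_eval.
Proof.
have evr a : quot_eval (ran a) = ran (quot_eval a).
  by rewrite ran_quot_eval -composite_pvertex -quot_eval_class.
have evs a : quot_eval (src a) = src (quot_eval a).
  by rewrite src_quot_eval -composite_pvertex -quot_eval_class.
split=> // a b ab.
(* Composability in the quotient only equates classes of length-0 paths; injectivity of [homv h]
   turns this into equality of vertices of [H]. *)
have pq : psource (repr a) = prange (repr b).
  apply: (homv_inj hP); apply: val_inj.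
  by rewrite -src_quot_eval -ran_quot_eval -evs -evr ab.
rewrite -[compose a b]/(path_class h (pcat (repr a) (repr b))) quot_eval_class.
apply: composite_cat; first by rewrite psource_map pq.
by move: (val_pcat pq); rewrite /= /prange /pedges /= => -> /=; rewrite map_cat.
Qed.

Lemma deg_quot_eval a : deg (quot_eval a) = iota (deg a).
Proof.
rewrite deg_composite /path_deg /= big_map (big_morph _ (embD iotaP) (emb0 iotaP)).
by apply: eq_bigr => e _; exact: color_home hP e.
Qed.

(** Induction on the total degree of [n]: an edge is split off at the range of [a], [home_lift] puts
    it in [H], and the remaining factor starts at the source of the lifted edge. *)
Lemma quot_eval_surj (a : Om) n x : deg a = iota n -> ran a = val (homv h x) ->
  exists a' : path_quot h, quot_eval a' = a.
Proof.
move=> da ra.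
suff [es [pes <-]] : exists es (pes : is_path x es),
    composite (map_gpath h (exist _ (x, es) pes)) = a.
  by exists (path_class h (exist _ (x, es) pes)); rewrite quot_eval_class.
have [C d0 dM fact] := kgraphP Om.
move: {2}(\sum_j n ord0 j)%N (erefl (\sum_j n ord0 j)%N) => N.
elim: N n a x da ra => [|N IH] n a x da ra sn.
  have n0 : n = 0.
    apply/rowP=> j; rewrite mxE; apply/eqP.
    by move/eqP: sn; rewrite sum_nat_eq0 => /forallP /(_ j).
  (* In degree 0, [a] is its own range, and the empty path at [x] evaluates to that range. *)
  exists [::], isT; apply: etrans (esym ra) _; apply: ran_deg0.
  by rewrite da n0 (emb0 iotaP).
have [j nj] : exists j, (0 < n ord0 j)%N.
  apply/existsP; rewrite -[[exists _, _]]negbK negb_exists; apply/negP => /forallP n0.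
  move: sn; rewrite big1 // => j _; apply/eqP.
  by move: (n0 j); rewrite -eqn0Ngt.
(* This is n - e_j; the truncated subtraction is exact because [n ord0 j] is positive. *)
pose n' : 'rV[nat]_l := \row_i (n ord0 i - (i == j))%N.
have En : n = delta_mx 0 j + n'.
  apply/rowP=> i; rewrite !mxE eqxx /=; case: eqP => [->|_].
    by rewrite -[RHS]/(1 + (n ord0 j - 1))%N subnKC.
  by rewrite -[RHS]/(0 + (n ord0 i - 0))%N add0n subn0.
have sn' : (\sum_i n' ord0 i)%N = N.
  apply: succn_inj; rewrite -sn.
  rewrite [RHS](bigD1 j) // [in LHS](bigD1 j) //= !mxE eqxx -addSn -addn1 subnK //.
  by congr addn; apply: eq_bigr => i /negbTE ij; rewrite mxE ij subn0.
have [|[b c] /= [[bc abc db dc] _]] := fact a (iota (delta_mx 0 j)) (iota n').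
  by rewrite da -(embD iotaP) -En.
have bE : is_edge b.
  by have [i Ei] := emb_delta iotaP j; apply/existsP; exists i; rewrite db Ei.
pose e : edge (skeleton Om) := exist _ b bE.
have re : eran e = homv h x.
  by apply: val_inj; rewrite /= -ra abc (ran_compose C).
have [e' he'] := home_lift hP (e := e) db re.
have xe : eran e' = x by apply: (homv_inj hP); rewrite -hom_eran he'.
have rc : ran c = val (homv h (esrc e')) by rewrite -hom_esrc he' /= bc.
have [es [pes Ec]] := IH _ _ _ dc rc sn'.
have pees : is_path x (e' :: es) by rewrite /= xe eqxx.
exists (e' :: es), pees; rewrite abc -Ec /=.
by rewrite -[b]/(val e) -he' /composite /psource /prange /= -hom_esrc.
Qed.

(** If [a] evaluates to bc, then b has the range of [a] and so lifts; c starts where the lift of b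
    ends and so lifts too. *)
Lemma path_quot_kgraph : is_kgraph (path_quot h).
Proof.
have C := kgraph_category (kgraphP Om).
apply: (factor_closed_kgraph (ev := quot_eval) quot_eval_inj quot_eval_functor
  (embD iotaP) (emb0 iotaP) (emb_inj iotaP) deg_quot_eval).
move=> a b c m n bc abc db dc.
have [|b' eb] := quot_eval_surj (x := prange (repr a)) db.
  by rewrite -ran_quot_eval abc (ran_compose C).
have [|c' ec] := quot_eval_surj (x := psource (repr b')) dc.
  by rewrite -src_quot_eval eb.
by exists b', c'.
Qed.

End PathQuotientEmbedding.

(** * Disjoint unions of path quotients *)

Section DisjointUnionIso.
Local Open Scope ring_scope.
Variables (k l : nat) (Om : kgraph k) (iota : 'rV[nat]_l -> 'rV[nat]_k).
Hypothesis iotaP : degree_embedding iota.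
Variables (I : countType) (H : I -> cgraph 'rV[nat]_l).
Variable h : forall i, graph_hom (H i) (skeleton Om).
Hypothesis hP : forall i, lifts_edges iota (h i).
Hypothesis h_disjoint : forall i j x y, homv (h i) x = homv (h j) y -> i = j.
Hypothesis h_cover : forall v, exists i x, homv (h i) x = v.
Variables (M : kgraphData l) (incl : M -> Om).
Hypotheses (incl_inj : injective incl) (incl_functor : is_functor incl).
Hypothesis deg_incl : forall a, deg (incl a) = iota (deg a).
Variable corestrict : forall (a : Om) n, deg a = iota n -> {m | incl m = a}.

(** The range of a composite determines its index by [h_disjoint], which gives injectivity across
    components. By [h_cover] every range lies in some slice, so [quot_eval_surj] gives
    surjectivity. *)
Lemma dunion_path_quot_iso :
  exists Phi : dunion (fun i => path_quot (h i)) -> M, is_kgraph_iso Phi /\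
    forall i p, incl (Phi (dinj (path_class (h i) p))) = composite (map_gpath (h i) p).
Proof.
set U := dunion _.
have duni (a : U) := corestrict (deg_quot_eval iotaP (hP (tag a)) (tagged a)).
(* [corestrict] is a sigma type rather than a mere existence statement, so its witness defines a
   function. *)
pose Phi (a : U) : M := sval (duni a).
have PhiE a : incl (Phi a) = quot_eval (tagged a) by exact: (svalP (duni a)).
exists Phi; split; last by move=> i p; rewrite PhiE /= quot_eval_class.
case: incl_functor => jr js jM.
split; last by move=> a; apply: (emb_inj iotaP); rewrite -deg_incl PhiE
  (deg_quot_eval iotaP (hP _)).
- have evF i := quot_eval_functor (hP i).
  have Pr a : Phi (ran a) = ran (Phi a).
    by apply: incl_inj; rewrite jr !PhiE /= (functor_ran (evF _)).
  have Ps a : Phi (src a) = src (Phi a).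
    by apply: incl_inj; rewrite js !PhiE /= (functor_src (evF _)).
  split=> // a b ab; apply: incl_inj.
  rewrite jM; last by rewrite -Pr -Ps ab.
  rewrite !PhiE; case: a b ab => i a [i' b] /= ab.
  (* Composable elements lie in the same component, where [tagged_as] is the identity. *)
  have ii' : i = i' by move: (congr1 tag ab).
  subst i'; move/eqP: ab; rewrite eq_Tagged /= => /eqP ab.
  by rewrite tagged_asE (functor_compose (evF i)).
- have Phi_inj : injective Phi.
    move=> [i a] [i' b] /(congr1 incl); rewrite !PhiE /= => ab.
    have ii' : i = i'.
      move: (congr1 (@ran Om) ab); rewrite !ran_quot_eval => /val_inj.
      exact: h_disjoint.
    by subst i'; rewrite (quot_eval_inj ab).
  have Phi_surj m : exists a, Phi a == m.
    have [i [x ix]] := h_cover (exist _ (ran (incl m)) (ran_is_vertex _)).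
    have [|a ea] := quot_eval_surj iotaP (hP i) (x := x) (deg_incl m).
      by rewrite ix.
    by exists (dinj a); apply/eqP/incl_inj; rewrite PhiE.
  (* The inverse is chosen with [xchoose], whence the boolean equality in [Phi_surj]. *)
  exists (fun m => xchoose (Phi_surj m)) => [a|m]; last exact/eqP/(xchooseP (Phi_surj m)).
  exact/Phi_inj/eqP/(xchooseP (Phi_surj (Phi a))).
Qed.

End DisjointUnionIso.

(** * The slices of a quasi-product *)

Section QuasiProductFibres.
Local Open Scope ring_scope.
Variables (k1 k2 : nat) (Lam : kgraph k1) (Gam : kgraph k2).
Variables (Om : kgraph (k1 + k2)) (Q : quasi_product Om Lam Gam).

Definition lemb (m : 'rV[nat]_k1) : 'rV[nat]_(k1 + k2) := row_mx m 0.
Definition remb (n : 'rV[nat]_k2) : 'rV[nat]_(k1 + k2) := row_mx 0 n.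

Lemma lemb_embedding : degree_embedding lemb.
Proof.
split=> [m n||m n /eq_row_mx[]|j] //; rewrite /lemb ?add_row_mx ?addr0 ?row_mx0 //.
by exists (lshift k2 j); rewrite delta_mx_lshift.
Qed.

Lemma remb_embedding : degree_embedding remb.
Proof.
split=> [m n||m n /eq_row_mx[]|j] //; rewrite /remb ?add_row_mx ?addr0 ?row_mx0 //.
by exists (rshift k1 j); rewrite delta_mx_rshift.
Qed.

Lemma isov_inv_inj : injective (isov_inv (qp_iso Q)).
Proof. exact: can_inj (isov_invK (qp_iso Q)). Qed.

Lemma incl_vertex_inj : injective (@incl_vertex _ _ Lam Gam).
Proof. by move=> [x w] [x' w'] /(congr1 val)[] /val_inj-> /val_inj->. Qed.

Lemma color_isoe_inv e : color (isoe_inv (qp_iso Q) e) = color e.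
Proof. by rewrite -(iso_color (qp_iso Q)) isoe_invK. Qed.

Lemma eran_isoe e v : eran e = isov_inv (qp_iso Q) v -> eran (isoe (qp_iso Q) e) = v.
Proof. by move=> re; rewrite iso_eran re isov_invK. Qed.

(** Lifting is checked in the skeleton of the product, where an edge is a pair: a colour in N^k1
    forces the second coordinate to have degree 0. *)
Lemma slice1_lifts_edges w : lifts_edges lemb (slice1_hom Q w).
Proof.
split=> [x y|e|e j x ce re].
- by move/isov_inv_inj/incl_vertex_inj/val_inj.
- rewrite color_isoe_inv /= /lemb; congr row_mx; exact/eqP/(valP (val e).2).
move: (eran_isoe re) (iso_color (qp_iso Q) e); rewrite ce.
case E: (isoe _ e) => [[a b] ab] /(congr1 val)[/= ra rb] /eq_row_mx[da db].
have aE : is_edge a by apply/existsP; exists j; rewrite da.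
(* A morphism of degree 0 equals its range, and the range of [b] is [w] since the edge ends in the
   slice. *)
have bw : b = val w by rewrite -(ran_deg0 db) rb (eqP (valP x)).
pose e' : edge (graph_slice1 (skeleton Lam) w) := exist _ (exist _ a aE, w) (eqxx w).
exists e'; apply: (can_inj (isoeK (qp_iso Q))).
by rewrite E /= isoe_invK; apply: val_inj; rewrite /= bw.
Qed.

Lemma slice2_lifts_edges x : lifts_edges remb (slice2_hom Q x).
Proof.
split=> [v v'|e|e j v ce re].
- by move/isov_inv_inj/incl_vertex_inj/val_inj.
- rewrite color_isoe_inv /= /remb; congr row_mx; exact/eqP/(valP (val e).1).
move: (eran_isoe re) (iso_color (qp_iso Q) e); rewrite ce.
case E: (isoe _ e) => [[a b] ab] /(congr1 val)[/= ra rb] /eq_row_mx[da db].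
have bE : is_edge b by apply/existsP; exists j; rewrite db.
have ax : a = val x by rewrite -(ran_deg0 da) ra (eqP (valP v)).
pose e' : edge (graph_slice2 (skeleton Gam) x) := exist _ (x, exist _ b bE) (eqxx x).
exists e'; apply: (can_inj (isoeK (qp_iso Q))).
by rewrite E /= isoe_invK; apply: val_inj; rewrite /= ax.
Qed.

Lemma slice1_disjoint w w' x y :
  homv (slice1_hom Q w) x = homv (slice1_hom Q w') y -> w = w'.
Proof.
by move/isov_inv_inj/incl_vertex_inj => xy; rewrite -(eqP (valP x)) xy (eqP (valP y)).
Qed.

Lemma slice2_disjoint w w' x y :
  homv (slice2_hom Q w) x = homv (slice2_hom Q w') y -> w = w'.
Proof.
by move/isov_inv_inj/incl_vertex_inj => xy; rewrite -(eqP (valP x)) xy (eqP (valP y)).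
Qed.

Lemma incl_vertex_surj v : exists x w, isov_inv (qp_iso Q) (incl_vertex (x, w)) = v.
Proof.
case E: (isov (qp_iso Q) v) => [[a b] ab].
(* A pair has degree 0 only if both coordinates do, so it is a pair of vertices. *)
have /eqP := ab; rewrite /is_vertex /= -row_mx0 => /eq_row_mx[/eqP da /eqP db].
exists (exist _ a da), (exist _ b db).
by rewrite -[RHS](isovK (qp_iso Q)) E; congr (isov_inv (qp_iso Q) _); apply: val_inj.
Qed.

Lemma slice1_cover v : exists w x, homv (slice1_hom Q w) x = v.
Proof.
have [x [w <-]] := incl_vertex_surj v.
by exists w, (exist _ (x, w) (eqxx w)).
Qed.

Lemma slice2_cover v : exists x w, homv (slice2_hom Q x) w = v.
Proof.
have [x [w <-]] := incl_vertex_surj v.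
by exists x, (exist _ (x, w) (eqxx x)).
Qed.

Lemma Omega1_incl_functor : is_functor (val : Omega1 Om -> Om).
Proof.
(* Degrees add, so the composite stays in [Omega1] and [insubd] returns it. *)
split=> // a b /(congr1 val) /= ab; rewrite insubdK // unfold_in.
by rewrite (deg_compose (kgraphP Om)) // linearD /= (eqP (valP a)) (eqP (valP b)) addr0.
Qed.

Lemma Omega2_incl_functor : is_functor (val : Omega2 Om -> Om).
Proof.
split=> // a b /(congr1 val) /= ab; rewrite insubdK // unfold_in.
by rewrite (deg_compose (kgraphP Om)) // linearD /= (eqP (valP a)) (eqP (valP b)) addr0.
Qed.

Lemma deg_Omega1_incl (a : Omega1 Om) : deg (val a) = lemb (deg a).
Proof. by rewrite /lemb -[LHS]hsubmxK (eqP (valP a)). Qed.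

Lemma deg_Omega2_incl (a : Omega2 Om) : deg (val a) = remb (deg a).
Proof. by rewrite /remb -[LHS]hsubmxK (eqP (valP a)). Qed.

Lemma Omega1_corestrict (a : Om) n : deg a = lemb n -> {m : Omega1 Om | val m = a}.
Proof.
move=> da; have aP : rsubmx (deg a) == 0 by rewrite da row_mxKr.
by exists (exist _ a aP).
Qed.

Lemma Omega2_corestrict (a : Om) n : deg a = remb n -> {m : Omega2 Om | val m = a}.
Proof.
move=> da; have aP : lsubmx (deg a) == 0 by rewrite da row_mxKl.
by exists (exist _ a aP).
Qed.

End QuasiProductFibres.

(** * The two decompositions *)

Theorem proposition3p3 (k1 k2 : nat) (Lam : kgraph k1) (Gam : kgraph k2)
    (Om : kgraph (k1 + k2)) (Q : quasi_product Om Lam Gam) :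
  ((forall w : vert (skeleton Gam), is_kgraph (fibre1 Q w)) /\
   exists Phi : dunion (fibre1 Q) -> Omega1 Om,
     is_kgraph_iso Phi /\
     forall (w : vert (skeleton Gam)) (p : gpath (graph_slice1 (skeleton Lam) w)),
       val (Phi (dinj (path_class (slice1_hom Q w) p))) =
       composite (map_gpath (slice1_hom Q w) p)) /\
  ((forall x : vert (skeleton Lam), is_kgraph (fibre2 Q x)) /\
   exists Phi : dunion (fibre2 Q) -> Omega2 Om,
     is_kgraph_iso Phi /\
     forall (x : vert (skeleton Lam)) (p : gpath (graph_slice2 (skeleton Gam) x)),
       val (Phi (dinj (path_class (slice2_hom Q x) p))) =
       composite (map_gpath (slice2_hom Q x) p)).
Proof.
split; split.
- by move=> w; exact: (path_quot_kgraph (lemb_embedding k1 k2) (slice1_lifts_edges Q w)).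
- exact: (dunion_path_quot_iso (M := Omega1 Om)
  (lemb_embedding k1 k2) (slice1_lifts_edges Q)
    (@slice1_disjoint _ _ _ _ _ Q) (slice1_cover Q) val_inj (Omega1_incl_functor Om)
    (@deg_Omega1_incl _ _ Om) (@Omega1_corestrict _ _ Om)).
- by move=> x; exact: (path_quot_kgraph (remb_embedding k1 k2) (slice2_lifts_edges Q x)).
- exact: (dunion_path_quot_iso (M := Omega2 Om)
  (remb_embedding k1 k2) (slice2_lifts_edges Q)
    (@slice2_disjoint _ _ _ _ _ Q) (slice2_cover Q) val_inj (Omega2_incl_functor Om)
    (@deg_Omega2_incl _ _ Om) (@Omega2_corestrict _ _ Om)).
Qed.
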